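(* For every integer $n\geq 2$, $\eta_n=\omega(\widehat H_n)$, where $\omega$ denotes the clique number.
   Context: For $f\colon\mathbb F_2^n\to\mathbb F_2$ and $i\in\{1,\ldots,n\}$, let $L_i\colon\mathbb F_2^n\to\mathbb F_2^n$ be $L_i(x_1,\ldots,x_n)=(x_1,\ldots,x_{i-1},f(x_1,\ldots,x_n),x_{i+1},\ldots,x_n)$. With $\mathrm{id}=12\cdots n$ the identity permutation, the SDS map is $F=[K_n,f,\mathrm{id}]=L_n\circ L_{n-1}\circ\cdots\circ L_1$ (the sequential dynamical system on the complete graph $K_n$ in which every vertex has vertex function $f$). The phase space $\Gamma(F)$ is the directed graph on vertex set $\mathbb F_2^n$ with an edge $\vec x\to F(\vec x)$ for each $\vec x$; a $2$-cycle is a set $\{\vec x,F(\vec x)\}$ with $F(\vec x)\neq\vec x$ and $F(F(\vec x))=\vec x$. Let $\eta(f,\mathrm{id})$ be the number of $2$-cycles of $\Gamma([K_n,f,\mathrm{id}])$, and $\eta_n=\max_{f}\eta(f,\mathrm{id})$, the maximum over all functions $f\colon\mathbb F_2^n\to\mathbb F_2$. A vector $(y_1,\ldots,y_n)\in\mathbb F_2^n$ contains the subsequence $101$ if there exist indices $i_1<i_2<i_3$ with $y_{i_1}=1$, $y_{i_2}=0$, $y_{i_3}=1$. The graph $\widehat H_n$ is the simple undirected graph whose vertex set is $\{(x_1,\ldots,x_n)\in\mathbb F_2^n: x_1=0\}$, with $\vec x,\vec y$ adjacent iff $\vec x\neq\vec y$ and $\vec x+\vec y$ contains the subsequence $101$.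 *)

(* Defs.v *)
From mathcomp Require Import all_boot all_order all_algebra.

Set Implicit Arguments.
Unset Strict Implicit.
Unset Printing Implicit Defensive.

Import GRing.Theory.
Local Open Scope ring_scope.

Section SDS.
Variable n : nat.
Implicit Types (f : {ffun 'rV['F_2]_n -> 'F_2}) (x y : 'rV['F_2]_n).

Definition local_map f (i : 'I_n) x : 'rV['F_2]_n :=
  \row_j (if j == i then f x else x 0 j).

(* [K_n, f, id] = L_n \o ... \o L_1: [enum 'I_n] lists the (0-based) vertices
   in increasing order, and [foldl] updates the first one first. *)
Definition sds_map f x : 'rV['F_2]_n :=
  foldl (fun y i => local_map f i y) x (enum 'I_n).

Definition two_cycles f : {set {set 'rV['F_2]_n}} :=
  [set [set x; sds_map f x] | x : 'rV['F_2]_n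
     & (sds_map f x != x) && (sds_map f (sds_map f x) == x)].

Definition eta f : nat := #|two_cycles f|.

Definition contains101 y : bool :=
  [exists i1 : 'I_n, exists i2 : 'I_n, exists i3 : 'I_n,
    [&& (i1 < i2)%N, (i2 < i3)%N, y 0 i1 == 1, y 0 i2 == 0 & y 0 i3 == 1]].

(* The first coordinate has index 0; the quantifier avoids requiring n to be
   syntactically a successor. *)
Definition first_coord0 x : bool :=
  [forall i : 'I_n, (nat_of_ord i == 0%N) ==> (x 0 i == 0)].

End SDS.

Definition eta_max (n : nat) : nat :=
  \max_(f : {ffun 'rV['F_2]_n -> 'F_2}) eta f.

Definition Hhat_vertex (n : nat) := {x : 'rV['F_2]_n | first_coord0 x}.

Definition Hhat_adj (n : nat) : rel (Hhat_vertex n) :=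
  fun x y => (x != y) && contains101 (val x + val y).

Definition is_clique (T : finType) (e : rel T) (A : {set T}) : bool :=
  [forall x in A, forall y in A, (x != y) ==> e x y].

Definition clique_number (T : finType) (e : rel T) : nat :=
  \max_(A : {set T} | is_clique e A) #|A|.

Lemma Hhat_adj_irrefl (n : nat) : irreflexive (@Hhat_adj n).
Proof. by move=> x; rewrite /Hhat_adj eqxx. Qed.

Lemma Hhat_adj_sym (n : nat) : symmetric (@Hhat_adj n).
Proof. by move=> x y; rewrite /Hhat_adj eq_sym addrC. Qed.

(* Main.v *)
Require Import Defs.
From mathcomp Require Import all_boot all_order all_algebra zify.

(** Since [y = F x] satisfies [y_i = f (y_1, .., y_(i-1), x_i, .., x_n)], a
    2-cycle {x, y} prescribes f on the 2n hybrids of x and y. If x_i = y_i then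
    two consecutive hybrids coincide and the agreement of x and y propagates
    cyclically to all coordinates; hence y is the complement of x, and each
    2-cycle has exactly one representative with x_1 = 0. Complementary pairs
    impose consistent requirements on f iff no two of their hybrids coincide
    with different prescribed values. Two hybrids of x and z coincide only if
    x + z is, up to complement, the indicator of an interval, which is
    incompatible with x + z starting with 0 and containing 101. Conversely, if
    x + z is a nonempty interval not containing the first index, there are two
    coincidences of hybrids, exactly one of which is contradictory. *)

Set Implicit Arguments.
Unset Strict Implicit.
Unset Printing Implicit Defensive.

Import GRing.Theory.
Local Open Scope ring_scope.

(** * Bits as booleans, and intervals of indices *)

Lemma F2_boolE (a : 'F_2) : a = (a == 1)%:R.
Proof. by case: a => [[|[|]]] //= h; apply/val_inj. Qed.

Lemma F2_natr_eq (b c : bool) : (b%:R == c%:R :> 'F_2) = (b == c).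
Proof. by case: b; case: c. Qed.

Lemma F2_natrD (b c : bool) : b%:R + c%:R = (b (+) c)%:R :> 'F_2.
Proof. by case: b; case: c; apply/val_inj. Qed.

Lemma F2_addrr (a : 'F_2) : a + a = 0.
Proof. by rewrite (F2_boolE a) F2_natrD addbb. Qed.

(** Take [i] least in [d] and [j] the first place after [i] where [d] fails; a later element [k] of
    [d] would make [i], [j], [k] a forbidden pattern. *)
Lemma interval_of_no101 (d : pred nat) n :
    ~~ d 0%N -> (exists2 k, (k < n)%N & d k) ->
    (forall i1 i2 i3, (i1 < i2)%N -> (i2 < i3)%N -> (i3 < n)%N ->
       d i1 -> ~~ d i2 -> d i3 -> False) ->
  exists i j, [/\ (0 < i)%N, (i < j)%N, (j <= n)%N
    & forall k, (k < n)%N -> d k = (i <= k < j)%N].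
Proof.
move=> d0 [k0 k0n dk0] no101.
have [i di i_min] := ex_minnP (ex_intro d k0 dk0).
have i_k0 : (i <= k0)%N by apply: i_min.
(* The alternative [j == n] ensures that a minimum exists even when [d] holds up to the end. *)
have exj : exists j, (i < j)%N && ((j == n) || ~~ d j).
  by exists n; rewrite eqxx andbT; lia.
have [j /andP[ij dj] j_min] := ex_minnP exj.
have jn : (j <= n)%N by apply: j_min; rewrite eqxx andbT; lia.
exists i, j; split=> // [|k kn].
  by rewrite lt0n; apply: contraNneq d0 => <-.
have [ki|ik] := ltnP k i.
  by apply/negbTE; apply: contraL ki => /i_min; rewrite -leqNgt.
have [kj|jk] := ltnP k j.
  have [<-|ik'] := eqVneq i k; first by rewrite di.
  apply: contraT => dk; have : (j <= k)%N by apply: j_min; rewrite dk orbT; lia.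
  by rewrite leqNgt kj.
apply/negbTE/negP => dk; have {}dj : ~~ d j by case/orP: dj => // /eqP jE; lia.
have [jkE|jk'] := eqVneq j k; first by rewrite jkE dk in dj.
by apply: (no101 i j k) => //; lia.
Qed.

(** * Hybrids as intermediate states of the sequential update *)

Definition hybrid n (y x : 'rV['F_2]_n) (k : nat) : 'rV['F_2]_n :=
  \row_j (if (j < k)%N then y 0 j else x 0 j).

Definition sds_state n (f : {ffun 'rV['F_2]_n -> 'F_2}) x (k : nat) :=
  foldl (fun y i => local_map f i y) x (take k (enum 'I_n)).

Section SdsMap.
Variables (n : nat) (f : {ffun 'rV['F_2]_n -> 'F_2}).
Implicit Types x y : 'rV['F_2]_n.

Lemma sds_stateS x (i : 'I_n) :
  sds_state f x i.+1 = local_map f i (sds_state f x i).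
Proof.
rewrite /sds_state (take_nth i) ?size_enum_ord // -cats1 foldl_cat /=.
by rewrite nth_ord_enum.
Qed.

Lemma sds_state_ge x k (j : 'I_n) :
  (k <= j)%N -> sds_state f x k 0 j = x 0 j.
Proof.
elim: k => [|k IHk] kj; first by rewrite /sds_state take0.
have kn : (k < n)%N by apply: ltn_trans kj (ltn_ord j).
rewrite (sds_stateS x (Ordinal kn)) mxE IHk 1?ltnW //.
by rewrite -val_eqE /= gtn_eqF.
Qed.

Lemma sds_state_lt x k (j : 'I_n) :
  (j < k <= n)%N -> sds_state f x k 0 j = sds_state f x j.+1 0 j.
Proof.
elim: k => // k IHk /andP[jk kn].
have [->//|jk'] := eqVneq (j : nat) k.
have {}jk : (j < k)%N by lia.
rewrite (sds_stateS x (Ordinal kn)) mxE -val_eqE /= ltn_eqF // IHk //.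
by rewrite jk ltnW.
Qed.

(** Coordinate [j] changes only at step [j]: before it the coordinate is that of [x], after it that
    of the final image. *)
Lemma sds_stateE x k :
  (k <= n)%N -> sds_state f x k = hybrid (sds_map f x) x k.
Proof.
move=> kn; apply/rowP=> j; rewrite mxE.
case: ltnP => [jk|kj]; last exact: sds_state_ge.
have -> : sds_map f x = sds_state f x n.
  by rewrite /sds_state take_oversize ?size_enum_ord.
by rewrite sds_state_lt ?jk // [RHS]sds_state_lt ?ltn_ord /=.
Qed.

Lemma hybrid_full y x : hybrid y x n = y.
Proof. by apply/rowP=> j; rewrite mxE ltn_ord. Qed.

Lemma hybrid0 y x : hybrid y x 0 = x.
Proof. by apply/rowP=> j; rewrite mxE. Qed.

Lemma hybridS y x (i : 'I_n) : y 0 i = x 0 i ->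
  hybrid y x i.+1 = hybrid y x i.
Proof.
move=> yx; apply/rowP=> j; rewrite !mxE ltnS leq_eqVlt.
by have [/val_inj->|] := eqVneq (j : nat) i; rewrite //= ltnn yx.
Qed.

(** For the converse, the prescribed values of [f] force each successive state to be the next
    hybrid, and the last hybrid is [y]. *)
Lemma sds_mapP x y :
  sds_map f x = y <-> forall i : 'I_n, f (hybrid y x i) = y 0 i.
Proof.
split=> [<- i|fxy].
  have := sds_stateE x (ltn_ord i); rewrite sds_stateS => /rowP/(_ i).
  by rewrite !mxE eqxx ltnSn sds_stateE // ltnW.
have fxyE k : (k <= n)%N -> sds_state f x k = hybrid y x k.
  elim: k => [|k IHk] kn; first by rewrite /sds_state take0 hybrid0.
  rewrite (sds_stateS x (Ordinal kn)) IHk 1?ltnW //; apply/rowP=> j.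
  rewrite !mxE (fxy (Ordinal kn)) ltnS [in RHS]leq_eqVlt -val_eqE /=.
  by have [jk|] := eqVneq (j : nat) k; rewrite //= -(_ : j = Ordinal kn) //;
     apply: val_inj.
by rewrite -[LHS](hybrid_full _ x) -sds_stateE // fxyE // hybrid_full.
Qed.

End SdsMap.

(** * Complementary pairs and 2-cycles *)

Definition flip n (t : bool) (x : 'rV['F_2]_n) : 'rV['F_2]_n :=
  \row_j (x 0 j + t%:R).

(* The i-th hybrid of the complementary pair formed by [flip t x] and
   [flip (~~ t) x]. *)
Definition flip_prefix n (x : 'rV['F_2]_n) (t : bool) (i : nat) :
    'rV['F_2]_n :=
  \row_j (x 0 j + (t (+) (j < i)%N)%:R).

Section TwoCycles.
Variable n : nat.
Implicit Types (x y z : 'rV['F_2]_n.+1) (f : {ffun 'rV['F_2]_n.+1 -> 'F_2}).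

Lemma flip0 x : flip false x = x.
Proof. by apply/rowP=> j; rewrite mxE addr0. Qed.

Lemma flipK : involutive (@flip n.+1 true).
Proof.
by move=> x; apply/rowP=> j; rewrite !mxE -addrA F2_natrD addr0.
Qed.

Lemma flip_neq x : flip true x != x.
Proof.
apply/eqP=> /rowP/(_ ord0)/eqP.
by rewrite mxE -subr_eq0 addrC addKr oner_eq0.
Qed.

Lemma hybrid_flip t x i :
  hybrid (flip (~~ t) x) (flip t x) i = flip_prefix x t i.
Proof.
by apply/rowP=> j; rewrite !mxE; case: ifP => _; rewrite ?addbT ?addbF.
Qed.

Lemma sds_map_flipP f t x :
  sds_map f (flip t x) = flip (~~ t) x <->
  forall i : 'I_n.+1, f (flip_prefix x t i) = x 0 i + (~~ t)%:R.
Proof.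
rewrite sds_mapP; split=> fx i; move: (fx i);
  by rewrite hybrid_flip !mxE.
Qed.

Definition complement_cycle f x :=
  (sds_map f x == flip true x) && (sds_map f (flip true x) == x).

(** The bit [t] selects the starting vector of the pair; the prescribed value is coordinate [i] of
    the other one. *)
Lemma complement_cycleP f x :
  reflect (forall t (i : 'I_n.+1), f (flip_prefix x t i) = x 0 i + (~~ t)%:R)
          (complement_cycle f x).
Proof.
apply: (iffP andP) => [[/eqP f0 /eqP f1] [] | fx].
- by apply/sds_map_flipP; rewrite /= flip0.
- by apply/sds_map_flipP; rewrite /= flip0.
split; apply/eqP.
  by have /sds_map_flipP := fx false; rewrite flip0.
by have /sds_map_flipP := fx true; rewrite /= flip0.
Qed.

Lemma complement_cycle_flip f x :
  complement_cycle f (flip true x) = complement_cycle f x.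
Proof. by rewrite /complement_cycle flipK andbC. Qed.

(* Equality at i makes the hybrids i and i+1 coincide, so it passes from i to
   i+1, and cyclically from the last coordinate to the first. *)
Lemma two_cycle_flip f x :
  sds_map f x != x -> sds_map f (sds_map f x) = x ->
  sds_map f x = flip true x.
Proof.
set y := sds_map f x => yx fyx.
have fx (i : 'I_n.+1) : f (hybrid y x i) = y 0 i by move: i; apply/sds_mapP.
have fy (i : 'I_n.+1) : f (hybrid x y i) = x 0 i by move: i; apply/sds_mapP.
have agreeS (i j : 'I_n.+1) :
    (j = i.+1 :> nat) -> x 0 i = y 0 i -> x 0 j = y 0 j.
  move=> ji xyi; rewrite -fx -fy ji !hybridS //.
  by rewrite fx fy.
have agree_wrap : x 0 ord_max = y 0 ord_max -> x 0 ord0 = y 0 ord0.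
  move=> xyn; rewrite -fx -fy /= !hybrid0.
  (* The full hybrid in one order is the zeroth hybrid in the other; agreement at [ord_max] then
     allows the last update to be dropped. *)
  rewrite -{1}(hybrid_full y x) -{2}(hybrid_full x y).
  rewrite (hybridS (i := ord_max)) // (hybridS (i := ord_max)) //.
  by rewrite fx fy.
have agree_up (i j : 'I_n.+1) :
    (i <= j)%N -> x 0 i = y 0 i -> x 0 j = y 0 j.
  case: j => j; elim: j => [|j IHj] jn /= ij xyi.
    by rewrite [Ordinal _](_ : _ = i) //; apply: val_inj => /=; lia.
  have [ij'|ij'] := eqVneq (i : nat) j.+1.
    by rewrite [Ordinal _](_ : _ = i) //; apply: val_inj.
  apply: (agreeS (Ordinal (ltnW jn))) => //.
  by apply: IHj => //; rewrite /=; lia.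
apply/rowP=> i; rewrite mxE.
have [xyi|xyi] := eqVneq (x 0 i) (y 0 i); last first.
  move: xyi; rewrite (F2_boolE (x 0 i)) (F2_boolE (y 0 i)) F2_natr_eq F2_natrD.
  by case: (_ == 1); case: (_ == 1).
case/eqP: yx; apply/rowP=> j; apply/esym.
apply: (agree_up ord0) => //; apply/agree_wrap/(agree_up i) => //.
exact: leq_ord.
Qed.

Lemma two_cyclesE f :
  two_cycles f = [set [set x; flip true x] | x in complement_cycle f].
Proof.
apply/setP=> c; apply/imsetP/imsetP=> -[x].
  rewrite inE => /andP[fx /eqP ffx] ->; have fxE := two_cycle_flip fx ffx.
  by exists x; rewrite -?fxE // -topredE /= /complement_cycle -fxE ffx !eqxx.
rewrite -topredE /= => /andP[/eqP fx /eqP ffx] ->.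
by exists x; rewrite ?inE fx // ffx flip_neq eqxx.
Qed.

Lemma first_coord0E x : first_coord0 x = (x 0 ord0 == 0).
Proof.
apply/forallP/idP => [/(_ ord0)//|x0 i]; apply/implyP=> /eqP i0.
by rewrite (_ : i = ord0) //; apply: val_inj.
Qed.

Lemma first_coord0_flip x : first_coord0 (flip true x) = ~~ first_coord0 x.
Proof.
by rewrite !first_coord0E mxE (F2_boolE (x 0 _)); case: (_ == 1).
Qed.

Definition cycle_reps f : {set Hhat_vertex n.+1} :=
  [set v | complement_cycle f (val v)].

(** Complementing toggles the first coordinate, so each pair has exactly one member among the
    vertices. *)
Lemma eta_cycle_reps f : eta f = #|cycle_reps f|.
Proof.
pose pair (v : Hhat_vertex n.+1) := [set val v; flip true (val v)].
have pair_inj : injective pair.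
  move=> u v uv; have : val u \in pair v by rewrite -uv set21.
  rewrite !inE => /orP[/eqP/val_inj//|/eqP uE].
  by have := valP u; rewrite uE first_coord0_flip (valP v).
rewrite /eta two_cyclesE -(card_imset _ pair_inj); apply: eq_card => c.
apply/imsetP/imsetP=> -[x]; last by rewrite inE => fx ->; exists (val x).
rewrite -topredE /= => fx ->.
have [x0|x0] := boolP (first_coord0 x).
  by exists (Sub x x0 : Hhat_vertex n.+1); rewrite ?inE /pair ?SubK.
have x1 : first_coord0 (flip true x) by rewrite first_coord0_flip.
exists (Sub (flip true x) x1 : Hhat_vertex n.+1).
  by rewrite inE SubK complement_cycle_flip.
by rewrite /pair SubK flipK setUC.
Qed.

(** * Consistency of the prescriptions of two pairs, and the subsequence 101 *)

Definition compatible x z :=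
  forall t s (i j : 'I_n.+1), flip_prefix x t i = flip_prefix z s j ->
    x 0 i + (~~ t)%:R = z 0 j + (~~ s)%:R.

Lemma flip_prefix_eqP x z t s i j :
  flip_prefix x t i = flip_prefix z s j <->
  forall k : 'I_n.+1, ((x + z) 0 k == 1) = t (+) s (+) (k < i)%N (+) (k < j)%N.
Proof.
have step k : flip_prefix x t i 0 k == flip_prefix z s j 0 k =
    (((x + z) 0 k == 1) == t (+) s (+) (k < i)%N (+) (k < j)%N).
  rewrite !mxE (F2_boolE (x 0 k)) (F2_boolE (z 0 k)) !F2_natrD.
  rewrite F2_natr_eq (F2_natr_eq _ true).
  case: (x 0 k == 1); case: (z 0 k == 1); case: (k < i)%N; case: (k < j)%N;
    by case: t; case: s.
split=> [/rowP xz k|xz].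
  by have := step k; rewrite xz eqxx => /esym/eqP.
by apply/rowP=> k; apply/eqP; rewrite step xz eqxx.
Qed.

Lemma compatible_refl x : compatible x x.
Proof.
move=> t s i j /flip_prefix_eqP xx.
have {}xx (k : 'I_n.+1) : t (+) s (+) (k < i)%N (+) (k < j)%N = false.
  by rewrite -xx mxE F2_addrr.
(* The last coordinate lies in neither prefix, hence compares [t] and [s] alone. *)
have ts : t = s.
  move: (xx ord_max); rewrite /= !ltnNge !leq_ord /= !addbF.
  by case: t {xx}; case: s.
rewrite (_ : i = j) ?ts //; apply: val_inj; move: (xx i) (xx j).
by rewrite ts !addbb !ltnn addbF; case: (ltngtP i j).
Qed.

Lemma contains101P x :
  reflect (exists i1 i2 i3 : 'I_n.+1, [/\ (i1 < i2)%N, (i2 < i3)%N,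
     x 0 i1 == 1, (x 0 i2 == 1) = false & x 0 i3 == 1]) (contains101 x).
Proof.
have F2_eq0 (a : 'F_2) : (a == 0) = ((a == 1) == false).
  by rewrite (F2_boolE a); case: (a == 1).
rewrite /contains101.
apply: (iffP existsP) => [[i1 /existsP[i2 /existsP[i3 /and5P[]]]]|].
  by rewrite F2_eq0 => ? ? ? /eqP ? ?; exists i1, i2, i3.
case=> i1 [i2 [i3 [i12 i23 x1 x2 x3]]]; exists i1.
apply/existsP; exists i2; apply/existsP; exists i3.
by rewrite F2_eq0 i12 i23 x1 x2 x3.
Qed.

(** No hybrids coincide at all: as [k] grows, the right side of [flip_prefix_eqP] changes only at
    [i] and [j], whereas a leading 0 followed by 101 needs three changes. *)
Lemma contains101_compatible x z :
  first_coord0 x -> first_coord0 z -> contains101 (x + z) -> compatible x z.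
Proof.
rewrite !first_coord0E => /eqP x0 /eqP z0.
case/contains101P=> i1 [i2 [i3 [i12 i23 d1 d2 d3]]] t s i j /flip_prefix_eqP d.
move: (d ord0) (d i1) (d i2) (d i3) => {d}.
rewrite d1 d2 d3 mxE x0 z0 addr0 /=.
case: t; case: s => /=; case: (ltnP i1 i); case: (ltnP i2 i);
case: (ltnP i3 i); case: (ltnP i1 j); case: (ltnP i2 j);
case: (ltnP i3 j); case: (ltnP 0 i); case: (ltnP 0 j) => //=; lia.
Qed.

Lemma compatible_contains101 x z :
    first_coord0 x -> first_coord0 z -> x != z -> compatible x z ->
  contains101 (x + z).
Proof.
rewrite !first_coord0E => /eqP x0 /eqP z0 xz xz_comp.
apply: contraT => no101; pose d k := (x + z) 0 (inord k) == 1.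
have dE (k : 'I_n.+1) : ((x + z) 0 k == 1) = d k by rewrite /d inord_val.
have [i [j [i0 ij jn dij]]] : exists i j, [/\ (0 < i)%N, (i < j)%N, (j <= n.+1)%N
    & forall k, (k < n.+1)%N -> d k = (i <= k < j)%N].
  apply: interval_of_no101.
  - by rewrite -(dE ord0) mxE x0 z0 addr0.
  - have [k xzk] : exists k, x 0 k != z 0 k.
      apply/existsP; rewrite -negb_forall; apply: contra xz => /forallP xz.
      by apply/eqP/rowP=> k; apply/eqP.
    exists k => //; rewrite -dE mxE; move: xzk.
    rewrite (F2_boolE (x 0 k)) (F2_boolE (z 0 k)) F2_natrD (F2_natr_eq _ true).
    by rewrite F2_natr_eq; case: (_ == 1); case: (_ == 1).
  - move=> i1 i2 i3 i12 i23 i3n d1 d2 d3; case/negP: no101.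
    by apply/contains101P; exists (inord i1), (inord i2), (inord i3);
       split=> //; rewrite ?inordK //; try lia; exact: negbTE.
have iN : (i < n.+1)%N by lia.
have := dE (Ordinal iN); rewrite dij //= leqnn ij mxE.
(* If the interval stops before the end, the coincidences give [x] at [i] equal to [z] at [j] and
   vice versa, so [x + z] would agree at [i] and [j]. *)
have [jN|jN] := ltnP j n.+1.
  have := dE (Ordinal jN); rewrite dij //= ltnn andbF mxE.
  have /xz_comp : flip_prefix x true (Ordinal iN) =
                  flip_prefix z true (Ordinal jN).
    by apply/flip_prefix_eqP => k; rewrite dE dij //=; lia.
  have /xz_comp : flip_prefix x true (Ordinal jN) =
                  flip_prefix z true (Ordinal iN).
    by apply/flip_prefix_eqP => k; rewrite dE dij //=; lia.
  rewrite /= !addr0 => -> <-.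
  by rewrite addrC => ->.
(* Here [j] is [n.+1], and hybrid [n.+1] in one order is hybrid 0 in the other. Both [x] and [z] are
   then forced to be 1 at [i], where their sum must be 1. *)
have /xz_comp : flip_prefix x false (@ord0 n) = flip_prefix z true (Ordinal iN).
  by apply/flip_prefix_eqP => k; rewrite dE dij //=; have := ltn_ord k; lia.
have /xz_comp : flip_prefix x true (Ordinal iN) = flip_prefix z false (@ord0 n).
  by apply/flip_prefix_eqP => k; rewrite dE dij //=; have := ltn_ord k; lia.
by rewrite /= x0 z0 !addr0 => -> <-; rewrite F2_addrr.
Qed.

(** * From functions to cliques and back *)

Lemma cycle_reps_clique f : is_clique (@Hhat_adj n.+1) (cycle_reps f).
Proof.
apply/forall_inP=> u; rewrite inE => /complement_cycleP fu.
apply/forall_inP=> v; rewrite inE => /complement_cycleP fv.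
apply/implyP=> uv; rewrite /Hhat_adj uv; apply: compatible_contains101;
  rewrite ?(valP u) ?(valP v) ?(inj_eq val_inj) //.
by move=> t s i j uvij; rewrite -fu uvij fv.
Qed.

(** Inclusion is enough to compare the two maxima. *)
Lemma clique_cycle_reps (A : {set Hhat_vertex n.+1}) :
  is_clique (@Hhat_adj n.+1) A -> exists f, A \subset cycle_reps f.
Proof.
move=> /forall_inP clA.
have compA u v : u \in A -> v \in A -> compatible (val u) (val v).
  move=> uA vA; have [->|uv] := eqVneq u v; first exact: compatible_refl.
  have /forall_inP/(_ v vA)/implyP/(_ uv)/andP[_] := clA u uA.
  by apply: contains101_compatible; rewrite ?(valP u) ?(valP v).
pose hit w (p : Hhat_vertex n.+1 * bool * 'I_n.+1) :=
  (p.1.1 \in A) && (flip_prefix (val p.1.1) p.1.2 p.2 == w).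
(* Compatibility makes the value independent of the picked hybrid; 0 is an arbitrary value off the
   hybrids of [A]. *)
exists [ffun w => if [pick p | hit w p] is Some p
                  then val p.1.1 0 p.2 + (~~ p.1.2)%:R else 0].
apply/subsetP=> u uA; rewrite inE; apply/complement_cycleP=> t i.
rewrite ffunE; case: pickP => [[[v s] j] /andP[/= vA /eqP vu]|/(_ (u, t, i))].
  exact: compA vu.
by rewrite /hit /= uA eqxx.
Qed.

End TwoCycles.

Theorem theorem1 (n : nat) (hn : (2 <= n)%N) :
  eta_max n = clique_number (@Hhat_adj n).
Proof.
case: n hn => // n _; apply/eqP; rewrite eqn_leq; apply/andP; split.
  apply/bigmax_leqP=> f _; rewrite eta_cycle_reps.
  exact: leq_bigmax_cond (cycle_reps_clique f).
apply/bigmax_leqP=> A /clique_cycle_reps[f Af].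
rewrite (leq_trans (subset_leq_card Af)) // -eta_cycle_reps.
exact: leq_bigmax.
Qed.
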